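(* Let $\mu$ be a compactly supported nonnegative Borel probability measure on $\mathbb{R}^d$, and let $K:\mathbb{R}^d\times\mathbb{R}^d\to[0,\infty)$ be a symmetric, $(\mu\times\mu)$-integrable continuous function. Define $$U_Kf(x)=\int K(x,y)f(y)\,d\mu(y),\qquad f\in C_0(\mathbb{R}^d),$$ and suppose that $$\int\int K(x,y)\,d\mu(x)\,d\mu(y)>0$$ and that $U_K:L^2(\mu)\to L^2(\mu)$ continuously. Then for any $k\ge 1$, $$\int\cdots\int K(x^1,x^2)K(x^2,x^3)\cdots K(x^k,x^{k+1})\,d\mu(x^1)\,d\mu(x^2)\cdots d\mu(x^{k+1})>0.$$ More generally, let $T$ be a tree graph on $n$ vertices, $n\ge 2$, with edge map $\mathcal{E}_T$, and define $K^*:(\mathbb{R}^d)^n\to[0,\infty)$ by $$K^*(x^1,\dots,x^n)=\prod_{1\le i<j\le n,\ \mathcal{E}_T(i,j)=1}K(x^i,x^j).$$ Then $$\int\cdots\int K^*(x^1,\dots,x^n)\,d\mu(x^1)\,d\mu(x^2)\cdots d\mu(x^n)>0.$$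
   Context: For an undirected graph $T$ with vertices labelled $1,\dots,n$, the edge map $\mathcal{E}_T$ is defined by $\mathcal{E}_T(i,j)=1$ if $i\ne j$ and the $i$-th and $j$-th vertices are connected by an edge, and $\mathcal{E}_T(i,j)=0$ otherwise. A tree graph is a finite connected graph without cycles. The statement ''$U_K:L^2(\mu)\to L^2(\mu)$ continuously'' means that $U_K$ extends to a bounded linear operator on $L^2(\mu)$. *)

(* Defs.v *)
From HB Require Import structures.
From mathcomp Require Import all_boot all_order all_algebra.
From mathcomp Require Import all_classical all_reals all_analysis.

Set Implicit Arguments.
Unset Strict Implicit.
Unset Printing Implicit Defensive.

Import Order.TTheory GRing.Theory Num.Theory.
Import numFieldNormedType.Exports.

Local Open Scope classical_set_scope.
Local Open Scope ring_scope.

(* R^d is 'rV[R]_d with the library topology (that of the sup norm); the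
   instance below equips it with its Borel sigma-algebra. *)
HB.instance Definition _ (R : realType) (m n : nat) :=
  Measurable.copy 'M[R]_(m, n) (g_sigma_algebraType (@open 'M[R]_(m, n))).

Section analysis.
Context (R : realType) (d : nat).
Local Notation X := 'rV[R]_d.
Implicit Types (mu : probability X R) (K : X -> X -> R).

Definition msupport mu : set X :=
  [set x | forall U : set X, open_nbhs x U -> (0 < mu U)%E].

Definition compactly_supported mu : Prop := compact (msupport mu).

(* Continuous functions vanishing at infinity. *)
Definition C0 : set (X -> R) :=
  [set f | continuous f /\
    forall e : R, 0 < e ->
      exists2 C : set X, compact C & forall x, ~ C x -> `|f x| < e].

Definition U_op mu K (f : X -> R) : X -> R :=
  fun x => (\int[mu]_y (K x y * f y))%R.

(* LfunType consists of square-integrable functions, not of their classes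
   modulo mu-a.e. equality, and the library puts no vector space structure on
   the quotient. An operator on L^2(mu) is therefore given by a choice A of
   representatives, linear up to mu-null sets; the norm bound makes it
   compatible with mu-a.e. equality. *)
Definition bounded_L2_operator mu
    (A : LfunType mu (lee1n 2) -> LfunType mu (lee1n 2)) : Prop :=
  (forall (a : R) (f g : LfunType mu (lee1n 2)),
     (A (a *: f + g) : X -> R) = (a *: A f + A g : X -> R) %[ae mu]) /\
  (exists C : R, forall f : LfunType mu (lee1n 2),
     ('N[mu]_2[EFin \o A f] <= C%:E * 'N[mu]_2[EFin \o f])%E).

(* As mu is finite, every element of C0 is square-integrable, hence underlies
   some f : LfunType mu (lee1n 2). *)
Definition extends_to_bounded_L2 mu (U : (X -> R) -> (X -> R)) : Prop :=
  exists A : LfunType mu (lee1n 2) -> LfunType mu (lee1n 2),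
    bounded_L2_operator A /\
    forall f : LfunType mu (lee1n 2),
      C0 f -> (A f : X -> R) = U f %[ae mu].

(* int ... int F(x^1,...,x^n) dmu(x^1) ... dmu(x^n), with x^1 integrated
   first. *)
Fixpoint iterated_integral mu (n : nat) :
    (n.-tuple X -> \bar R) -> \bar R :=
  match n with
  | 0 => fun F => F [tuple]
  | m.+1 => fun F =>
      (\int[mu]_x iterated_integral mu (fun v : m.-tuple X =>
         F (rcons_tuple v x)))%E
  end.

Definition chain_kernel K (k : nat) (x : k.+1.-tuple X) : R :=
  \prod_(i < k) K (tnth x (widen_ord (leqnSn k) i)) (tnth x (lift ord0 i)).

End analysis.

Section graphs.
Context (n : nat).
Implicit Types T : rel 'I_n.

Definition edge_map T (i j : 'I_n) : nat := (i != j) && T i j.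

(* A loop is a cycle, whence irreflexivity; ucycle lists a cycle without
   repetition, and those of length 2 merely traverse one edge back and forth. *)
Definition is_tree T : Prop :=
  [/\ symmetric T,
      forall i j : 'I_n, connect T i j,
      irreflexive T
    & forall c : seq 'I_n, (2 < size c)%N -> ~ ucycle T c].

Definition graph_kernel (R : realType) (d : nat)
    (K : 'rV[R]_d -> 'rV[R]_d -> R) T (x : n.-tuple 'rV[R]_d) : R :=
  \prod_(p : 'I_n * 'I_n | (p.1 < p.2)%N && (edge_map T p.1 p.2 == 1%N))
     K (tnth x p.1) (tnth x p.2).

End graphs.

(* Main.v *)
Require Import Defs.
From mathcomp Require Import all_boot all_order all_algebra.
From mathcomp Require Import all_classical all_reals all_analysis.

Import Order.TTheory GRing.Theory Num.Theory.
Import numFieldNormedType.Exports.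

Local Open Scope classical_set_scope.
Local Open Scope ring_scope.

(** Continuity of K makes the positivity a matter of finding a box on which the
integrand is bounded below. The complement of the support of mu is mu-null,
because R^d has a countable base. As the double integral of K is positive, K
therefore cannot vanish on the square of the support: there are x0, y0 in the
support with 0 < K x0 y0 ([exists_msupport_gt0]). By continuity K stays above
some c > 0 on a product of open neighbourhoods A of x0 and B of y0, and these
have positive measure by the definition of the support
([exists_rectangle_gt]).

A tree is bipartite ([tree_bipartite]), and so is a chain, coloured by the
parity of the index. Let x^i range over A when i has the first colour and over
B when it has the second. Each edge joins the two colours, so by symmetry of K
every factor of the integrand is at least c on this box. The iterated integral
is then at least a power of c times the product of the measures of the sides
([iterated_integral_ge_box]), which is positive.

The estimates for integrals are proved for arbitrary nonnegative functions: the
integral of such a function is the supremum of the integrals of the simple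
functions below it, which is monotone. This way no measurability of sections of
K or of partial integrals has to be established. *)

Set Implicit Arguments.
Unset Strict Implicit.

(** * Bipartite graphs *)

(** A closed walk which repeats a vertex x splits at x into two shorter closed
walks, so by induction a closed walk of odd length contains an odd closed walk
without repetition, that is a loop or a cycle of length at least 3. *)

Lemma cycle_even_size (V : finType) (T : rel V) :
  irreflexive T -> (forall c : seq V, (2 < size c)%N -> ~ ucycle T c) ->
  forall c : seq V, cycle T c -> ~~ odd (size c).
Proof.
move=> Tirr Tacyc c; have [m] := ubnP (size c).
elim: m c => // m IHm c; rewrite ltnS => le_cm Tc.
case Uc: (uniq c).
  have [/Tacyc|] := ltnP 2 (size c); first by rewrite /ucycle Tc Uc => /(_ isT).
  by case: c Tc {le_cm Uc} => [|x [|y []]] //=; rewrite Tirr.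
have [p1 [x [p2 [p3 c_eq]]]] :
    exists p1 x p2 p3, c = p1 ++ x :: p2 ++ x :: p3.
  (* some vertex x occurs twice; rotating c to start at x exposes the split *)
  elim: c Uc {IHm le_cm Tc} => //= x c IHc.
  case xc: (x \in c) => /= Uc.
    by case/splitPr: xc => p2 p3; exists [::], x, p2, p3.
  by have [p1 [y [p2 [p3 ->]]]] := IHc Uc; exists (x :: p1), y, p2, p3.
have rot_c : rot (size p1) c = x :: p2 ++ x :: (p3 ++ p1).
  by rewrite c_eq rot_size_cat /= -catA.
have size_c : size c = (size (x :: p2) + size (x :: (p3 ++ p1)))%N.
  by rewrite -(size_rot (size p1) c) rot_c -size_cat.
move: Tc; rewrite -(rot_cycle (size p1)) rot_c /= rcons_cat /= cat_path /=.
case/and3P=> Tp2 Tlast Tp31.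
have even2 : ~~ odd (size (x :: p2)).
  apply: IHm; last by rewrite /= rcons_path Tp2.
  by apply: leq_trans le_cm; rewrite size_c /= addnS !ltnS leq_addr.
have even31 : ~~ odd (size (x :: (p3 ++ p1))).
  apply: IHm; last exact: Tp31.
  by apply: leq_trans le_cm; rewrite size_c /= addSn !ltnS leq_addl.
by rewrite size_c oddD (negbTE even2) (negbTE even31).
Qed.

(** The colour of a vertex is the parity of the length of a chosen path from a
root. An edge closes the paths to its ends up to a closed walk, whose length is
even; hence the two lengths have opposite parities. *)
Lemma tree_bipartite (n : nat) (T : rel 'I_n) : (0 < n)%N -> is_tree T ->
  exists col : 'I_n -> bool, forall i j, T i j -> col i != col j.
Proof.
case: n T => // n T _ [Tsym Tconn Tirr Tacyc].
have Teven := cycle_even_size Tirr Tacyc.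
have /fin_all_exists[p Tp] : forall i, exists p : seq 'I_n.+1,
    path T ord0 p /\ last ord0 p = i.
  by move=> i; have /connectP[p Tp ->] := Tconn ord0 i; exists p.
exists (fun i => odd (size (p i))) => i j Tij.
have [[Tpi lasti] [Tpj lastj]] := (Tp i, Tp j).
have Trev : path T j (rev (belast ord0 (p j))).
  rewrite -{1}lastj rev_path (@eq_path _ _ T) // => x y; exact: Tsym.
have last_rev : last j (rev (belast ord0 (p j))) = ord0.
  by rewrite -{1}lastj; case: (p j) => //= y q; rewrite rev_cons last_rcons.
pose s := p i ++ j :: rev (belast ord0 (p j)).
have Ts : path T ord0 s by rewrite cat_path Tpi lasti /= Tij.
have lasts : last ord0 s = ord0 by rewrite last_cat.
have sizes : size s = (size (p i) + (size (p j)).+1)%N.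
  by rewrite size_cat /= size_rev size_belast.
have : cycle T s.
  case: s Ts lasts {sizes} => //= y q /andP[T0y Tq] lastq.
  by rewrite rcons_path Tq lastq.
move/Teven; rewrite sizes oddD /=.
by case: (odd _); case: (odd _).
Qed.

(** * Integrals of nonnegative functions without measurability *)

Section integrals.
Context (dsp : measure_display) (X : measurableType dsp) (R : realType).
Variable mu : {measure set X -> \bar R}.
Local Open Scope ereal_scope.

Lemma ge0_le_integral_nonmeas (f g : X -> \bar R) :
  (forall x, 0 <= f x) -> (forall x, f x <= g x) ->
  \int[mu]_x f x <= \int[mu]_x g x.
Proof.
move=> f0 fg.
have g0 x : 0 <= g x := le_trans (f0 x) (fg x).
rewrite !ge0_integralTE//; apply: le_ereal_sup => _ [h hf <-].
by exists h => // x; exact: le_trans (hf x) (fg x).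
Qed.

Lemma integral_ge_cst_on (A : set X) (e : \bar R) (f : X -> \bar R) :
  measurable A -> 0 <= e -> (forall x, 0 <= f x) ->
  (forall x, A x -> e <= f x) -> e * mu A <= \int[mu]_x f x.
Proof.
move=> mA e0 f0 ef; rewrite -integral_cst// integral_mkcond.
by apply: ge0_le_integral_nonmeas => x; rewrite patchE; case: ifPn => //;
  rewrite inE => /ef.
Qed.

Lemma integral_eq0_off_negligible (N : set X) (f : X -> \bar R) :
  mu.-negligible N -> (forall x, 0 <= f x) -> (forall x, ~ N x -> f x = 0) ->
  \int[mu]_x f x = 0.
Proof.
move=> [M [mM M0 NM]] f0 fN; apply/eqP; rewrite eq_le integral_ge0// andbT.
apply: (@le_trans _ _ (\int[mu]_x (cst +oo \_ M) x)).
  apply: ge0_le_integral_nonmeas => // x; rewrite patchE; case: ifPn => [|xM].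
    by rewrite leey.
  by rewrite fN// => /NM Mx; move: xM; rewrite notin_setE.
by rewrite -integral_mkcond integral_cst//= M0 mule0.
Qed.

End integrals.

(** * The support of a probability measure on R^d *)

Section euclidean.
Context (R : realType) (d : nat).
Local Notation X := 'rV[R]_d.
Implicit Types (mu : probability X R) (K : X -> X -> R).

Lemma open_measurable_rV (U : set X) : open U -> measurable U.
Proof. exact: sub_sigma_algebra. Qed.

(** A countable family of balls that serves as a base. The radius is taken below
half that of a ball around x inside U, so that the triangle inequality keeps B
inside U. *)
Lemma rat_ball_nbhs (x : X) (U : set X) : nbhs x U ->
  exists (q : 'rV[rat]_d) (k : nat),
    let B := ball (map_mx ratr q : X) k.+1%:R^-1 in B x /\ B `<=` U.
Proof.
rewrite -nbhs_ballE => -[e /= e0 eU].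
have [k] : exists k, 0 + k.+1%:R^-1 < e / 2.
  by apply: ltr_add_invr; rewrite divr_gt0.
rewrite add0r => ke.
have k0 : 0 < k.+1%:R^-1 :> R by rewrite invr_gt0.
have /fin_all_exists[q qx] : forall j : 'I_d, exists r : rat,
    ball (ratr r : R) k.+1%:R^-1 (x ord0 j).
  move=> j; have [|r] :=
    @rat_in_itvoo R (x ord0 j - k.+1%:R^-1) (x ord0 j + k.+1%:R^-1).
    by rewrite ltrBlDr -addrA ltrDl addr_gt0.
  by rewrite in_itv/= => rx; exists r; rewrite /ball/= distrC ltr_distlC.
have Bx : ball (map_mx ratr (\row_j q j) : X) k.+1%:R^-1 x.
  by split=> // i j; rewrite !mxE ord1; exact: qx.
exists (\row_j q j), k; split=> // z Bz; apply: eU => /=.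
apply: (@le_ball _ _ _ (k.+1%:R^-1 + k.+1%:R^-1)).
  by rewrite [leRHS]splitr lerD// ltW.
by apply: ball_triangle Bz; exact: ball_sym.
Qed.

(** Every point outside the support has a null neighbourhood, hence lies in one
of the countably many null balls of [rat_ball_nbhs]. *)
Lemma negligible_setC_msupport mu : mu.-negligible (~` msupport mu).
Proof.
pose B (p : 'rV[rat]_d * nat) : set X :=
  ball (map_mx ratr p.1 : X) p.2.+1%:R^-1.
pose F k : set X := if unpickle k is Some p
  then if `[< mu.-negligible (B p) >] then B p else set0 else set0.
apply: (@negligibleS _ _ _ _ (\bigcup_k F k)).
  move=> x /existsNP[U /not_implyP[[oU Ux] /negP muU]].
  have U0 : mu.-negligible U.
    apply/negligibleP; first exact: open_measurable_rV.
    by apply/eqP; rewrite eq_le measure_ge0 andbT leNgt.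
  have [q [n [Bx BU]]] := rat_ball_nbhs (open_nbhs_nbhs (conj oU Ux)).
  exists (pickle (q, n)) => //; rewrite /F pickleK.
  by rewrite asboolT//; exact: negligibleS U0.
apply: negligible_bigcup => k; rewrite /F.
case: unpickle => [p|]; last exact: negligible_set0.
by case: asboolP => // _; exact: negligible_set0.
Qed.

(** If K vanished on the square of the support, then for y in the support
x |-> K x y would vanish off a null set; so would the inner integral as a
function of y, and the double integral would be 0. *)
Lemma exists_msupport_gt0 mu K : (forall x y, 0 <= K x y) ->
  (0 < \int[mu]_y \int[mu]_x (K x y)%:E)%E ->
  exists x y, [/\ msupport mu x, msupport mu y & 0 < K x y].
Proof.
move=> K0; apply: contraPP => noxy; apply/negP; rewrite -leNgt.
have N0 := negligible_setC_msupport mu.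
rewrite (integral_eq0_off_negligible N0)// => [y|y].
  by apply: integral_ge0 => x _; rewrite lee_fin.
move=> /contrapT suppy.
apply: (integral_eq0_off_negligible N0) => x.
  by rewrite lee_fin.
move=> /contrapT suppx; congr EFin; apply/eqP/negPn/negP => Kxy.
by apply: noxy; exists x, y; split => //; rewrite lt_neqAle eq_sym Kxy K0.
Qed.

Lemma exists_rectangle_gt mu K : (forall x y, 0 <= K x y) ->
  continuous (fun z : X * X => K z.1 z.2) ->
  (0 < \int[mu]_y \int[mu]_x (K x y)%:E)%E ->
  exists (A B : set X) (c : R),
    [/\ measurable A /\ measurable B, (0 < mu A)%E /\ (0 < mu B)%E, 0 < c
      & forall x y, A x -> B y -> c <= K x y].
Proof.
move=> K0 Kc /(exists_msupport_gt0 K0)[x [y [sx sy Kxy]]].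
have Kxy2 : K x y / 2 < K x y by rewrite gtr_pMr// invf_lt1// ltr1n.
have [[A B] /= [nA nB] AB] :
    nbhs (x, y) [set z : X * X | K x y / 2 < K z.1 z.2].
  exact: (cvgr_gt _ (Kc (x, y)) _ Kxy2).
move: nA nB; rewrite !nbhsE => -[A' oA' AA'] [B' oB' BB'].
exists A', B', (K x y / 2); split.
- by split; apply: open_measurable_rV; [case: oA'|case: oB'].
- by split; [exact: sx|exact: sy].
- by rewrite divr_gt0.
- move=> a b /AA' Aa /BB' Bb; apply: ltW; exact: (AB (a, b)).
Qed.

(** * Iterated integrals of products of kernels *)

Lemma iterated_integral_ge0 mu n (F : n.-tuple X -> \bar R) :
  (forall v, 0 <= F v)%E -> (0 <= iterated_integral mu F)%E.
Proof.
elim: n F => [|n IHn] F F0 //=; apply: integral_ge0 => x _.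
by apply: IHn => v; exact: F0.
Qed.

(** Induction on n: once the last coordinate is fixed in its side of the box, the
inner iterated integral is bounded below by the measure of the remaining box,
a bound that no longer depends on that coordinate. *)
Lemma iterated_integral_ge_box mu n (A : 'I_n -> set X)
    (F : n.-tuple X -> \bar R) (c : \bar R) :
  (forall i, measurable (A i)) -> (0 <= c)%E -> (forall v, 0 <= F v)%E ->
  (forall v, (forall i, A i (tnth v i)) -> c <= F v)%E ->
  (c * \prod_(i < n) mu (A i) <= iterated_integral mu F)%E.
Proof.
move=> + c0; elim: n A F => [|n IHn] A F mA F0 cF /=.
  by rewrite big_ord0 mule1; apply: cF => -[].
have tnthw (v : n.-tuple X) x (i : 'I_n) :
    tnth (rcons_tuple v x) (widen_ord (leqnSn n) i) = tnth v i.
  by rewrite !(tnth_nth x) /= nth_rcons size_tuple ltn_ord.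
have tnthm (v : n.-tuple X) x : tnth (rcons_tuple v x) ord_max = x.
  by rewrite (tnth_nth x) /= nth_rcons size_tuple ltnn eqxx.
rewrite big_ord_recr /= muleA; apply: integral_ge_cst_on => //.
- by rewrite mule_ge0// prode_ge0.
- by move=> x; exact: iterated_integral_ge0.
move=> x Ax; apply: (IHn (fun i => A (widen_ord (leqnSn n) i))) => // v Av.
apply: cF => i; have [lt_in|le_ni] := ltnP i n.
  have -> : i = widen_ord (leqnSn n) (Ordinal lt_in) by exact: val_inj.
  by rewrite tnthw; exact: Av.
have -> : i = ord_max by apply/val_inj/anti_leq; rewrite /= le_ni -ltnS ltn_ord.
by rewrite tnthm.
Qed.

End euclidean.


(** The index type E and the endpoint maps s and t cover both a chain, whose
edges are the ordinals below k, and a graph, whose edges are pairs of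
vertices. *)
Lemma iterated_integral_prod_gt0 (R : realType) (d : nat)
    (mu : probability 'rV[R]_d R) (K : 'rV[R]_d -> 'rV[R]_d -> R)
    (n : nat) (E : finType) (P : pred E) (s t : E -> 'I_n)
    (col : 'I_n -> bool) :
  (forall x y, 0 <= K x y) -> (forall x y, K x y = K y x) ->
  continuous (fun z : 'rV[R]_d * 'rV[R]_d => K z.1 z.2) ->
  (0 < \int[mu]_y \int[mu]_x (K x y)%:E)%E ->
  (forall e, P e -> col (s e) != col (t e)) ->
  (0 < iterated_integral mu (fun v : n.-tuple 'rV[R]_d =>
         (\prod_(e | P e) K (tnth v (s e)) (tnth v (t e)))%:E))%E.
Proof.
move=> K0 Ksym Kcont Kpos col_st.
have [A [B [c [[mA mB] [A0 B0] c0 cK]]]] := exists_rectangle_gt K0 Kcont Kpos.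
pose Q i := if col i then A else B.
have c'0 : 0 < \prod_(e | P e) c by exact: prodr_gt0.
apply: (@lt_le_trans _ _ ((\prod_(e | P e) c)%:E * \prod_(i < n) mu (Q i))%E).
  rewrite mule_gt0 ?lte_fin//.
  elim/big_ind: _ => [|a b a0 b0|i _]; rewrite ?lte01 ?mule_gt0// /Q.
  by case: (col i).
apply: iterated_integral_ge_box.
- by move=> i; rewrite /Q; case: (col i).
- by rewrite lee_fin ltW.
- by move=> v; rewrite lee_fin prodr_ge0.
move=> v Qv; rewrite lee_fin; apply: ler_prod => e Pe; rewrite ltW//=.
have := col_st e Pe; move: (Qv (s e)) (Qv (t e)); rewrite /Q.
by case: (col (s e)); case: (col (t e)) => // ? ? _; [|rewrite Ksym]; exact: cK.
Qed.

Unset Implicit Arguments.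
Set Strict Implicit.

Theorem theorem1p3 (R : realType) (d : nat)
  (mu : probability 'rV[R]_d R)
  (mu_cpt : compactly_supported mu)
  (K : 'rV[R]_d -> 'rV[R]_d -> R)
  (K_ge0 : forall x y, 0 <= K x y)
  (K_sym : forall x y, K x y = K y x)
  (K_cont : continuous (fun z : 'rV[R]_d * 'rV[R]_d => K z.1 z.2))
  (K_int : (mu \x mu)%E.-integrable setT
             (fun z : 'rV[R]_d * 'rV[R]_d => (K z.1 z.2)%:E))
  (K_pos : (0 < \int[mu]_y \int[mu]_x (K x y)%:E)%E)
  (U_bdd : extends_to_bounded_L2 mu (U_op mu K)) :
  (forall k : nat, (1 <= k)%N ->
     (0 < iterated_integral mu
            (fun x : k.+1.-tuple 'rV[R]_d => (chain_kernel K x)%:E))%E) /\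
  (forall (n : nat) (T : rel 'I_n), (2 <= n)%N -> is_tree T ->
     (0 < iterated_integral mu
            (fun x : n.-tuple 'rV[R]_d => (graph_kernel K T x)%:E))%E).
Proof.
split=> [k _|n T n2 Ttree].
  apply: (iterated_integral_prod_gt0 (col := fun i : 'I_k.+1 => odd i))
    => // i _.
  by rewrite /=; case: (odd i).
have [col colP] := tree_bipartite (ltnW n2) Ttree.
apply: (iterated_integral_prod_gt0 (col := col)) => // -[i j] /=.
by case/andP=> _; rewrite /edge_map eqb1 => /andP[_]; exact: colP.
Qed.
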